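(* Let $G$ be a finite group, $p$ a prime, and suppose $G$ contains a strongly $p$-embedded subgroup $S$. Assume that there exists a subgroup $T\le G$ such that $N_G(\langle g\rangle,T)\subseteq TS$ for all elements $g\in S$ of order $p$, and such that $p$ divides $|S\cap T|$ and $T\not\subseteq S$. For each integer $m\ge 1$ let $\Gamma_m$ be the $G$-graph whose vertex set is the disjoint union of $G/S$ and $m$ copies $(G/T)_1,\dots,(G/T)_m$ of $G/T$, and whose edge set is the disjoint union of $m$ copies $(G/(S\cap T))_1,\dots,(G/(S\cap T))_m$ of $G/(S\cap T)$, where the edge $x(S\cap T)$ in the $i$-th copy joins the vertex $xS$ to the vertex $xT$ in $(G/T)_i$. Then the $\Gamma_m$ ($m\ge 1$) form an infinite family of $1$-dimensional slender synthetic buildings for $G$ at the prime $p$, all of distinct homotopy types.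
   Context: For subgroups $H,K\le G$, $N_G(H,K)=\{x\in G : xHx^{-1}\subseteq K\}$, and $TS=\{ts: t\in T,s\in S\}$. A proper subgroup $S<G$ is strongly $p$-embedded in $G$ if $p$ divides $|S|$ and $p$ does not divide $|S\cap gSg^{-1}|$ whenever $g\in G$, $g\notin S$. A $G$-simplicial complex is a finite (possibly empty) simplicial complex $\Delta$ with a simplicial action of the finite group $G$ such that the setwise stabilizer of each simplex fixes that simplex pointwise. For $H\le G$, $\Delta^H$ denotes the fixed point subcomplex. Contractible spaces are non-empty. A $G$-simplicial complex $\Delta$ is a synthetic building for $G$ at the prime $p$ if (1) $\Delta^P$ is $N_G(P)$-equivariantly contractible for every non-identity $p$-subgroup $P\le G$, and (2) the stabilizer of every simplex has order divisible by $p$. $\Delta$ is slender if the orbit space $G\backslash\Delta$ is contractible. *)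

(* Defs.v *)
From HB Require Import structures.
From mathcomp Require Import all_boot all_order all_algebra all_fingroup.
From mathcomp Require Import all_solvable generic_quotient.
From mathcomp Require Import all_classical all_reals all_analysis.

Set Implicit Arguments.
Unset Strict Implicit.
Unset Printing Implicit Defensive.

Import Order.TTheory GRing.Theory Num.Theory.
Import numFieldNormedType.Exports.

Local Open Scope ring_scope.

Section Groups.
Local Open Scope group_scope.
Variable G : finGroupType.

(* [A :^ x] is x^-1 A x, so the conjugate x A x^-1 is [A :^ x^-1]. *)
Definition transporter (H K : {set G}) : {set G} :=
  [set x : G | H :^ x^-1 \subset K]%SET.

Definition strongly_embedded (p : nat) (S : {group G}) : Prop :=
  [/\ S \proper [set: G]%SET,
      (p %| #|S|)%N &
      forall g : G, g \notin S -> ~~ (p %| #|S :&: S :^ g^-1|)%N].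

End Groups.

Section Homotopy.
Local Open Scope classical_set_scope.
Variable R : realType.

(* [H] is only constrained on X x [0, 1], although its domain is X x R. *)
Definition is_homotopy (X Y : topologicalType) (f g : X -> Y)
    (H : X * R -> Y) : Prop :=
  [/\ {within [set: X] `*` `[0, 1], continuous H},
      forall x, H (x, 0) = f x &
      forall x, H (x, 1) = g x].

Definition homotopic (X Y : topologicalType) (f g : X -> Y) : Prop :=
  exists H : X * R -> Y, is_homotopy f g H.

Definition homotopy_equivalent (X Y : topologicalType) : Prop :=
  exists (f : X -> Y) (g : Y -> X),
    [/\ continuous f, continuous g, homotopic (g \o f) id &
        homotopic (f \o g) id].

Definition contractible (X : topologicalType) : Prop :=
  exists x0 : X, homotopic id (fun _ : X => x0).

(* At time 1 the last condition says that [x0] is fixed by [N]. *)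
Definition equivariantly_contractible (G : finGroupType) (N : {set G})
    (X : topologicalType) (act : G -> X -> X) : Prop :=
  exists (x0 : X) (H : X * R -> X),
    is_homotopy id (fun _ : X => x0) H /\
    forall (a : G) (x : X) (t : R), a \in N -> 0 <= t <= 1 ->
      H (act a x, t) = act a (H (x, t)).

End Homotopy.

(* A complex is the set of its non-empty simplices; its vertices are the [v]  *)
(* with [[set v] \in K], so some elements of [V] may not be vertices.         *)
Definition simplicial_complex (V : finType) (K : {set {set V}}) : Prop :=
  finset.set0 \notin K /\
  forall s t : {set V}, s \in K -> t \subset s -> t != finset.set0 -> t \in K.

Definition has_dimension (V : finType) (K : {set {set V}}) (d : nat) : Prop :=
  (exists2 s : {set V}, s \in K & #|s| = d.+1) /\
  (forall s : {set V}, s \in K -> (#|s| <= d.+1)%N).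

Section Realization.
Variables (R : realType) (V : finType).

Definition coordinates := prod_topology (fun _ : V => (R : topologicalType)).

(* Barycentric coordinates with support a simplex. *)
Definition realization_set (K : {set {set V}}) : set coordinates :=
  [set x : coordinates | [/\ forall v, 0 <= x v,
     \sum_(v : V) x v = 1 & [set v : V | x v != 0]%SET \in K]]%classic.

Definition realization (K : {set {set V}}) : topologicalType :=
  set_type (realization_set K).

End Realization.

(* MathComp actions are right actions: a left action g.v of G is encoded by   *)
(* [to v g = g^-1.v]. Orbits and stabilisers are the same.                    *)
Section Complexes.
Variables (G : finGroupType) (V : finType) (to : {action G &-> V}).
Implicit Types (K : {set {set V}}) (P : {set G}).

Definition G_simplicial_complex K : Prop :=
  [/\ simplicial_complex K,
      [acts [set: G]%SET, on K | to^*] &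
      forall s : {set V}, s \in K -> ('N(s | to) \subset 'C(s | to))%g].

Definition fixed_subcomplex P K : {set {set V}} :=
  [set s in K | P \subset 'C(s | to)%g]%SET.

Variable R : realType.

(* (g.x)(v) = x(g^-1.v) *)
Definition coordinates_act (g : G) (x : coordinates R V) : coordinates R V :=
  fun v => x (to v g).

(* The default value of [insubd] is not used when [g] preserves [K]: see      *)
(* [realization_actE] and [fixed_subcomplex_acts].                            *)
Definition realization_act K (g : G) (x : realization R K) : realization R K :=
  insubd x (coordinates_act g (\val x)).

Lemma realization_actE K (N : {set G}) (g : G) (x : realization R K) :
  [acts N, on K | to^*] -> g \in N ->
  \val (realization_act g x) = coordinates_act g (\val x).
Proof.
move=> actK gN; rewrite /realization_act val_insubd ifT //.
have [x0 x1 xK] := set_mem (valP x).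
apply/mem_set; split => [v| |]; first exact: x0.
  rewrite -[RHS]x1 [RHS](reindex_inj (act_inj to g)) /=.
  exact: eq_bigr.
rewrite -(acts_act actK gN); congr (_ \in K): xK; apply/setP => v.
rewrite inE; apply/idP/imsetP => [xv|[w] /[swap] ->]; last by rewrite inE.
by exists (to v g^-1%g); rewrite ?inE /coordinates_act actKV.
Qed.

Lemma fixed_subcomplex_acts K P :
  [acts [set: G]%SET, on K | to^*] ->
  [acts 'N(P)%g, on fixed_subcomplex P K | to^*].
Proof.
move=> actK; apply/actsP => a aP s; rewrite !inE (acts_act actK) ?inE //=.
congr (_ && _); rewrite -/((to^*)%act s a) astab_setact ?inE //.
by rewrite -{1}(normP aP) conjSg.
Qed.

Definition orbit_rel K (x y : realization R K) : bool :=
  [exists g : G, \val y == coordinates_act g (\val x)].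

Lemma orbit_rel_equiv K : equiv_class_of (@orbit_rel K).
Proof.
have act1c (x : coordinates R V) : coordinates_act 1%g x = x.
  by apply: funext => v; rewrite /coordinates_act act1.
have actMc g h (x : coordinates R V) :
    coordinates_act g (coordinates_act h x) = coordinates_act (g * h)%g x.
  by apply: funext => v; rewrite /coordinates_act actM.
have sym x y : orbit_rel x y -> @orbit_rel K y x.
  move=> /existsP[g /eqP e]; apply/existsP; exists g^-1%g; apply/eqP.
  by rewrite e actMc mulVg act1c.
split=> [x|x y|y x z]; first by apply/existsP; exists 1%g; rewrite act1c.
  by apply/idP/idP; exact: sym.
move=> /existsP[g /eqP e] /existsP[h /eqP f]; apply/existsP; exists (h * g)%g.
by rewrite f e actMc.
Qed.

Canonical orbit_equiv K := EquivRelPack (orbit_rel_equiv K).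

Definition orbit_space K : topologicalType :=
  quotient_topology {eq_quot (orbit_equiv K)}%qT.

Definition synthetic_building (p : nat) K : Prop :=
  [/\ G_simplicial_complex K,
      forall P : {group G}, (p.-group P)%g -> P :!=: 1%g ->
        equivariantly_contractible R 'N(P)%g
          (@realization_act (fixed_subcomplex P K)) &
      forall s : {set V}, s \in K -> (p %| #|'N(s | to)%g|)%N].

Definition slender K : Prop := contractible R (orbit_space K).

End Complexes.

Section Gamma.
Local Open Scope group_scope.
Variables (G : finGroupType) (S T : {group G}) (m : nat).

(* Vertices live in the disjoint union of subsets of G and m copies of it;    *)
(* those which are not cosets of S, resp. T, do not occur in [Gamma].         *)
Definition gamma_vertex : finType := ({set G} + 'I_m * {set G})%type.

(* g.(xS) = (g * x)S and g.(xT)_i = ((g * x)T)_i *)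
Definition gamma_translate (v : gamma_vertex) (g : G) : gamma_vertex :=
  match v with
  | inl A => inl (g^-1 *: A)
  | inr (i, A) => inr (i, g^-1 *: A)
  end.

Lemma gamma_translate_is_action : is_action [set: G]%SET gamma_translate.
Proof.
apply: is_total_action => [[A|[i A]]|[A|[i A]] g h] /=;
  by rewrite ?invg1 ?mul1g ?lcosetE ?invMg ?lcosetM // -?mulgA.
Qed.

Definition gamma_act : {action G &-> gamma_vertex} :=
  Action gamma_translate_is_action.

Definition gamma_edge (i : 'I_m) (x : G) : {set gamma_vertex} :=
  [set inl (x *: S); inr (i, x *: T)]%SET.

Definition Gamma : {set {set gamma_vertex}} :=
  ([set [set inl (x *: S)] | x : G] :|:
   [set [set inr (i, x *: T)] | i : 'I_m, x : G] :|:
   [set gamma_edge i x | i : 'I_m, x : G])%SET.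

(* The edges are in bijection with m copies of G/(S :&: T): there are no      *)
(* multiple edges, so the graph is a simplicial complex.                      *)
Lemma gamma_edge_eq (i j : 'I_m) (x y : G) :
  (gamma_edge i x == gamma_edge j y) =
  (i == j) && (x *: (S :&: T) == y *: (S :&: T)).
Proof.
have memST z : (z \in x *: (S :&: T)) = (z \in x *: S) && (z \in x *: T).
  by rewrite !mem_lcoset inE.
have eqST : (x *: (S :&: T) == y *: (S :&: T)) =
            (x *: S == y *: S) && (x *: T == y *: T).
  have eqH (H : {group G}) : (x *: H == y *: H) = (x^-1 * y \in H).
    by rewrite eq_sym -mem_lcoset; apply/eqP/idP => [<-|/lcoset_eqP//];
      rewrite lcoset_refl.
  by rewrite !eqH inE.
rewrite eqST; apply/eqP/and3P => [/setP e | [/eqP-> /eqP eS /eqP eT]].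
  have := e (inl (x *: S)); have := e (inr (i, x *: T)).
  by rewrite !inE !eqxx /= => /esym/eqP[-> ->] /esym; rewrite orbF => /eqP[->].
by rewrite /gamma_edge eS eT.
Qed.

End Gamma.

(* Main.v *)
(* On the fixed points of a non-trivial p-subgroup P there is exactly one      *)
(* vertex xS, because S is strongly embedded, and by the transporter           *)
(* hypothesis every fixed vertex yT is joined to it by a fixed edge: the fixed *)
(* complex is a cone whose apex is fixed by N(P). The orbit space is a star    *)
(* with centre S and m leaves.                                                 *)
(*                                                                             *)
(* Homotopy types are distinguished by the first Betti number, in the form of  *)
(* an Alexander-Spanier cohomology: a cocycle is a function phi(x, y) of two   *)
(* points, not assumed continuous, such that phi(x, y) + phi(y, z) = phi(x, z) *)
(* for close points, and it is trivial when phi(x, y) = h(y) - h(x) for close  *)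
(* points. On a compact space homotopic maps pull phi back to cohomologous     *)
(* cocycles, and on a simplicial complex the values of phi along the edges     *)
(* decide whether phi is trivial. Passing from m to m + k copies adds          *)
(* k |G : S :&: T| edges but at most k |G : T| dimensions of coboundaries,     *)
(* and |G : T| < |G : S :&: T| since T is not contained in S.                  *)

Require Import Defs.
From HB Require Import structures.
From mathcomp Require Import all_boot all_order all_algebra all_fingroup.
From mathcomp Require Import all_solvable generic_quotient.
From mathcomp Require Import all_classical all_reals all_analysis.
From mathcomp Require Import zify ring lra.

Set Implicit Arguments.
Unset Strict Implicit.
Unset Printing Implicit Defensive.

Import Order.TTheory GRing.Theory Num.Theory.
Import numFieldNormedType.Exports.

Local Open Scope ring_scope.

(** * Topology of geometric realizations *)

(** The building and slenderness conditions come from explicit straight-line contractions: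
    [gamma_fixed_cone] and [gamma_norm_apex] feed [cone_contractible], and [fold] identifies the
    orbit space with a star.

    Homotopy types are separated by [Gamma_not_dominated]. Suppose maps [f] to [Gamma_m] and [g]
    back compose to a map [g \o f] homotopic to the identity of [Gamma_(m+k)]. Then pulling cocycles
    back along [g] and integrating them over the edges of [Gamma_m] is injective on first cohomology
    ([path_sum_coboundary], [homotopic_coboundary], [simplicial_coboundary]), so by
    [dim_preimage_le] the Betti number does not grow from [m] to [m + k]. But [dim_cochain],
    [dim_coboundaries_add] and [card_index_lt] show that it does. *)

Section RealizationTopology.
Local Open Scope classical_set_scope.
Variables (R : realType) (V : finType).

Lemma nbhs_forall (X : topologicalType) (I : finType) (x : X)
    (B : I -> set X) :
  (forall i, nbhs x (B i)) -> nbhs x [set y | forall i, B i y].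
Proof. by move=> xB; exact: (@filter_forall _ I B). Qed.

Definition dist_lt (e : R) (x y : coordinates R V) : Prop :=
  forall v, `|x v - y v| < e.

Lemma dist_lt_refl (e : R) x : 0 < e -> dist_lt e x x.
Proof. by move=> e0 v; rewrite subrr normr0. Qed.

Lemma dist_lt_sym (e : R) x y : dist_lt e x y -> dist_lt e y x.
Proof. by move=> xy v; rewrite distrC. Qed.

Lemma dist_lt_le (d e : R) x y : d <= e -> dist_lt d x y -> dist_lt e x y.
Proof. by move=> de xy v; exact: lt_le_trans (xy v) de. Qed.

Lemma dist_lt_trans (d e : R) x y z :
  dist_lt d x y -> dist_lt e y z -> dist_lt (d + e) x z.
Proof. by move=> xy yz v; apply: le_lt_trans (ler_distD (y v) _ _) (ltrD _ _). Qed.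

Lemma coordinate_continuous (v : V) :
  continuous (fun x : coordinates R V => x v).
Proof. exact: (@proj_continuous _ (fun=> R : topologicalType)). Qed.

(** As [V] is finite, the product topology is that of the sup distance; this turns neighbourhoods
    into estimates. *)
Lemma nbhs_coordinates (x : coordinates R V) (U : set (coordinates R V)) :
  nbhs x U <-> exists2 e, 0 < e & forall y, dist_lt e x y -> U y.
Proof.
split; last first.
  move=> [e e0 eU]; pose B v := [set y : coordinates R V | `|x v - y v| < e].
  have xB v : nbhs x (B v).
    exact: (@coordinate_continuous v x _ (nbhsx_ballx (x v) e e0)).
  have : nbhs x [set y | forall v, B v y] by exact: nbhs_forall.
  by apply: (@filterS _ _ (nbhs_filter x)) => y xy; apply: eU.
pose F := filter_from [set e : R | 0 < e] (fun e => [set y | dist_lt e x y]).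
have FF : Filter F.
  apply: filter_from_filter; first by exists 1 => /=.
  move=> d e /= d0 e0; exists (Num.min d e); first by rewrite /= lt_min d0.
  by move=> y xy; split; apply: dist_lt_le xy; rewrite ge_min lexx ?orbT.
(* Convergence in the product topology is tested on each coordinate. *)
suff FxU : F --> x by move=> /FxU[e e0 eU]; exists e.
apply/cvg_sup => v A [_ [[W oW <-] Wx WA]].
have /nbhs_ballP[e e0 eW] : nbhs (x v) W by exact: open_nbhs_nbhs.
by exists e => // y xy; apply/WA/eW/xy.
Qed.

Section Complex.
Variable K : {set {set V}}.

Lemma realization_val_continuous :
  continuous (fun x : realization R K => \val x).
Proof. exact: initial_continuous. Qed.

Lemma nbhs_realization (x : realization R K) (U : set (realization R K)) :
  nbhs x U <-> exists2 e, 0 < e & forall y, dist_lt e (\val x) (\val y) -> U y.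
Proof.
split => [[_ [[W oW <-] /= Wx WU]]|[e e0 eU]].
  have /nbhs_coordinates[e e0 eW] : nbhs (\val x) W by exact: open_nbhs_nbhs.
  by exists e => // y xy; apply/WU/eW.
suff : nbhs x [set y | dist_lt e (\val x) (\val y)].
  by apply: (@filterS _ _ (nbhs_filter x)) => y xy; apply: eU.
apply: (realization_val_continuous (x := x)); apply/nbhs_coordinates.
by exists e.
Qed.

Lemma realization_continuous (X : topologicalType) (f : X -> realization R K) :
  (forall v, continuous (fun x => \val (f x) v)) -> continuous f.
Proof.
move=> cf x U /nbhs_realization[e e0 eU].
pose B v := [set y | `|\val (f x) v - \val (f y) v| < e].
have xB v : nbhs x (B v).
  exact: (cf v x _ (nbhsx_ballx (\val (f x) v) e e0)).
have : nbhs x [set y | forall v, B v y] by exact: nbhs_forall.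
by apply: (@filterS _ _ (nbhs_filter x)) => y xy; apply: eU.
Qed.

Definition vsupport (x : coordinates R V) : {set V} := [set v | x v != 0]%SET.

Lemma realization_ge0 (x : realization R K) v : 0 <= \val x v.
Proof. by have [] := set_mem (valP x). Qed.

Lemma realization_sum1 (x : realization R K) : \sum_v \val x v = 1.
Proof. by have [] := set_mem (valP x). Qed.

Lemma realization_support (x : realization R K) : vsupport (\val x) \in K.
Proof. by have [] := set_mem (valP x). Qed.

Lemma realization_le1 (x : realization R K) v : \val x v <= 1.
Proof.
rewrite -(realization_sum1 x) (bigD1 v) //= lerDl.
by apply: sumr_ge0 => w _; exact: realization_ge0.
Qed.

(** Some coordinate reaches the average. This uniform bound makes [nearest] stable under small
    moves. *)
Lemma realization_exists_large (x : realization R K) :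
  exists v, #|V|%:R^-1 <= \val x v.
Proof.
apply/not_existsP => xs; have := realization_sum1 x.
have V0 : (0 < #|V|)%N.
  rewrite lt0n; apply/negP => /eqP V0; have := realization_sum1 x.
  rewrite big_pred0 => [/esym/eqP|v]; first by rewrite oner_eq0.
  by have := fintype0 v V0.
have [v0 _] : exists v : V, v \in V by apply/card_gt0P.
apply/eqP; rewrite lt_eqF //.
apply: (@lt_le_trans _ _ (\sum_(v : V) #|V|%:R^-1)).
  apply: ltr_sum; first by apply/hasP; exists v0; rewrite ?mem_index_enum.
  by move=> v _; rewrite ltNge; apply/negP/xs.
by rewrite sumr_const -[X in X <= _]mulr_natr mulVf // pnatr_eq0 -lt0n.
Qed.

Hypothesis K_complex : simplicial_complex K.

Lemma realization_set_sub (s : {set V}) (x : coordinates R V) :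
  s \in K -> (forall v, 0 <= x v) -> \sum_v x v = 1 ->
  (forall v, v \notin s -> x v = 0) -> realization_set K x.
Proof.
move=> sK x0 x1 xs; split => //; apply: (K_complex.2 _ _ sK).
  by apply/fintype.subsetP => v; rewrite inE; apply: contraR => /xs ->.
apply/negP => /eqP/setP e; suff : \sum_v x v = 0.
  by rewrite x1 => /eqP; rewrite oner_eq0.
by apply: big1 => v _; have := e v; rewrite !inE => /negbFE/eqP.
Qed.

(** Having support in some simplex is a finite union of closed vanishing conditions, so the
    realization is closed in a compact cube. *)
Lemma realization_compact : compact (@realization_set R V K).
Proof.
have -> : @realization_set R V K =
    [set x : coordinates R V | forall v, `[0, 1]%classic (x v)] `&`
    ([set x : coordinates R V | \sum_v x v = 1] `&`
     \bigcup_(s in [set` K]) \bigcap_(v in [set v | v \notin s])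
        [set x : coordinates R V | x v = 0]).
  apply/seteqP; split => x /=.
    move=> /[dup] xK [x0 x1 xs]; split; [|split => //].
      move=> v; rewrite in_itv /= x0 /=.
      by have := @realization_le1 (exist _ x (mem_set xK)) v.
    by exists (vsupport x) => // v /=; rewrite inE negbK => /eqP.
  move=> [x01 [x1 [s sK xs]]]; apply: (realization_set_sub sK) => // v.
  by have := x01 v; rewrite in_itv => /andP[].
apply: compact_closedI.
  apply: (@tychonoff _ (fun=> R : topologicalType) (fun=> `[0, 1]%classic)).
  by move=> _; exact: segment_compact.
have closed_preimage (f : coordinates R V -> R) (c : R) : continuous f ->
    closed [set x : coordinates R V | f x = c].
  by move=> /continuous_closedP cf; exact (cf [set y | y = c] (@closed_eq R c)).
apply: closedI.
  apply: closed_preimage; apply: continuous_big => [|v _].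
    exact: add_continuous.
  exact: coordinate_continuous.
apply: closed_bigcup => // s sK; apply: closed_bigI => v _.
by apply: closed_preimage; exact: coordinate_continuous.
Qed.

Lemma realization_type_compact : compact [set: realization R K].
Proof.
move=> F FF _; have [|x [xK Fx]] := realization_compact (fmap_proper_filter val FF).
  apply: (@filterE _ F _ (val @^-1` realization_set K)) => x.
  exact: (set_mem (valP x)).
exists (exist _ x (mem_set xK)); split => // A B FA /nbhs_realization[e e0 eB].
have [||_ [[y Ay <-] xy]] := Fx (val @` A) [set y | dist_lt e x y].
- apply: (@filterS _ F _ A (val @^-1` (val @` A))) => // y Ay.
  by exists y.
- by apply/nbhs_coordinates; exists e.
- by exists y; split => //; apply: eB.
Qed.
End Complex.
End RealizationTopology.

(** * Uniform continuity of maps and homotopies *)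

Section Uniform.
Local Open Scope classical_set_scope.
Variables (R : realType) (V W : finType).
Variables (K : {set {set V}}) (L : {set {set W}}).
Hypothesis K_complex : simplicial_complex K.

(** Heine-Cantor on the compact product with [[0, 1]]. *)
Lemma homotopy_uniformly_continuous
    (H : realization R K * R -> realization R L) :
  {within [set: realization R K] `*` `[0, 1], continuous H} ->
  forall e : R, 0 < e -> exists2 d : R, 0 < d &
    forall x y (s t : R), 0 <= s <= 1 -> 0 <= t <= 1 ->
      dist_lt d (\val x) (\val y) -> `|s - t| < d ->
      dist_lt e (\val (H (x, s))) (\val (H (y, t))).
Proof.
set A := _ `*` _ => /subspace_continuousP cH e e0.
have cA : compact A.
  apply: compact_setX; first exact: realization_type_compact.
  exact: segment_compact.
pose P (d : R) (q : realization R K * R) := forall z, A z ->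
  dist_lt d (\val q.1) (\val z.1) -> `|q.2 - z.2| < d ->
  dist_lt e (\val (H q)) (\val (H z)).
have AP : \forall d \near (0 : R)^'+, A `<=` P d.
  move: cA => /compact_near_coveringP/near_covering_withinP; apply => q Aq.
  have e2 : 0 < e / 2 by rewrite divr_gt0.
  have [[U1 U2] /= [/nbhs_realization[r1 r10 rU1] /nbhs_ballP[r2 r20 rU2]] UH] :
      nbhs q [set z | A z -> dist_lt (e / 2) (\val (H q)) (\val (H z))].
    apply: (cH q Aq [set y | dist_lt (e / 2) (\val (H q)) (\val y)]).
    by apply/nbhs_realization; exists (e / 2).
  (* Halving leaves room for two moves, from [q] to [q'] and from [q'] to [z]. *)
  pose r := Num.min r1 r2 / 2.
  have r0 : 0 < r by rewrite divr_gt0 // lt_min r10.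
  exists ([set z | dist_lt r (\val q.1) (\val z.1) /\ `|q.2 - z.2| < r],
          [set d | d < r]).
    split => /=; last exact: nbhs_right_lt.
    exists ([set x | dist_lt r (\val q.1) (\val x)], ball q.2 r).
      split => /=; last exact: nbhsx_ballx.
      by apply/nbhs_realization; exists r.
    by move=> z [].
  have rr : r + r = Num.min r1 r2 by rewrite /r -splitr.
  have rr1 : r + r <= r1 by rewrite rr ge_min lexx.
  have rr2 : r + r <= r2 by rewrite rr ge_min lexx orbT.
  move=> [q' d] /= [[qq'1 qq'2] dr] Aq' z Az q'z1 q'z2.
  have qH z' : A z' -> dist_lt (r + r) (\val q.1) (\val z'.1) ->
      `|q.2 - z'.2| < r + r -> dist_lt (e / 2) (\val (H q)) (\val (H z')).
    move=> Az' qz1 qz2; apply: UH => //; split.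
      exact/rU1/(dist_lt_le rr1).
    by apply: rU2; apply: lt_le_trans rr2.
  rewrite [e]splitr; apply: (@dist_lt_trans _ _ _ _ _ (\val (H q))).
    apply/dist_lt_sym/qH => //; first by apply: dist_lt_le qq'1; rewrite lerDl ltW.
    by apply: lt_le_trans qq'2 _; rewrite lerDl ltW.
  apply: qH => //.
    exact: (dist_lt_trans qq'1 (dist_lt_le (ltW dr) q'z1)).
  apply: le_lt_trans (ler_distD q'.2 _ _) (ltrD qq'2 (lt_trans q'z2 dr)).
have [d [dP d0]] : exists d, A `<=` P d /\ 0 < d.
  apply: (@filter_ex _ _ (at_right_proper_filter (0 : R))).
  by apply: filterI => //; exact: nbhs_right_gt.
exists d => // x y s t s01 t01 xy st.
by apply: (dP (x, s) _ (y, t)); rewrite /A /= ?in_itv.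
Qed.

Lemma uniformly_continuous (f : realization R K -> realization R L) :
  continuous f -> forall e : R, 0 < e -> exists2 d : R, 0 < d &
    forall x y, dist_lt d (\val x) (\val y) -> dist_lt e (\val (f x)) (\val (f y)).
Proof.
move=> cf e e0.
have [|d d0 df] := homotopy_uniformly_continuous (H := f \o fst) _ e0.
  apply: continuous_subspaceT => x; apply: continuous_comp; last exact: cf.
  exact: cvg_fst.
exists d => // x y xy; apply: (df x y 0 0) => //;
  by rewrite ?lexx ?ler01 ?subrr ?normr0.
Qed.

End Uniform.

(** * Alexander-Spanier cocycles *)

Lemma exists_invS_lt (R : realType) (d : R) :
  0 < d -> exists N : nat, N.+1%:R^-1 < d.
Proof.
move=> d0; exists (Num.truncn d^-1); rewrite invf_plt ?posrE ?ltr0Sn //.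
exact: truncnS_gt.
Qed.

Lemma ratio_in01 (R : realType) (N k : nat) :
  (k <= N.+1)%N -> 0 <= (k%:R / N.+1%:R : R) <= 1.
Proof.
by move=> kN; rewrite divr_ge0 ?ler0n //= ler_pdivrMr ?ltr0Sn // mul1r ler_nat.
Qed.

Lemma ratio_step (R : realType) (N k : nat) :
  `|k%:R / N.+1%:R - k.+1%:R / N.+1%:R| = N.+1%:R^-1 :> R.
Proof.
by rewrite -mulrBl mulrSr opprD addNKr mulN1r normrN ger0_norm // invr_ge0 ler0n.
Qed.

Section Cocycles.
Variables (R : realType) (V : finType) (K : {set {set V}}) (M : zmodType).
Local Notation X := (realization R K).
Implicit Types (x y z : X) (phi : X -> X -> M) (e : R).

Definition cocycle e phi : Prop := forall x y z,
  dist_lt e (\val x) (\val y) -> dist_lt e (\val y) (\val z) ->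
  dist_lt e (\val x) (\val z) -> phi x y + phi y z = phi x z.

Definition coboundary phi : Prop := exists h : X -> M, exists2 e, 0 < e &
  forall x y, dist_lt e (\val x) (\val y) -> phi x y = h y - h x.

Lemma cocycle_diag e phi x : 0 < e -> cocycle e phi -> phi x x = 0.
Proof.
move=> e0 cphi; have xx : dist_lt e (\val x) (\val x) by exact: dist_lt_refl.
by apply: (@addrI _ (phi x x)); rewrite addr0; exact: cphi.
Qed.

Lemma coboundaryD phi psi : coboundary phi -> coboundary psi ->
  coboundary (fun x y => phi x y + psi x y).
Proof.
move=> [h [d d0 dh]] [k [e e0 ek]]; exists (fun x => h x + k x).
exists (Num.min d e) => [|x y xy]; first by rewrite lt_min d0.
rewrite dh ?ek; [|by apply: dist_lt_le xy; rewrite ge_min lexx ?orbT..].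
by rewrite opprD addrACA.
Qed.

(** The diagonal from [p k] to [q k.+1] cuts each square of the ladder into two triangles, where the
    cocycle identity applies. *)
Lemma cocycle_ladder e phi (p q : nat -> X) (N : nat) : cocycle e phi ->
  (forall k, (k < N)%N -> [/\ dist_lt e (\val (p k)) (\val (p k.+1)),
     dist_lt e (\val (q k)) (\val (q k.+1)) &
     dist_lt e (\val (p k)) (\val (q k.+1))]) ->
  (forall k, (k <= N)%N -> dist_lt e (\val (p k)) (\val (q k))) ->
  \sum_(0 <= k < N) phi (p k) (p k.+1) + phi (p N) (q N) =
  phi (p 0%N) (q 0%N) + \sum_(0 <= k < N) phi (q k) (q k.+1).
Proof.
move=> cphi; elim: N => [|N IH] pq1 pq; first by rewrite !big_nil addr0 add0r.
rewrite !big_nat_recr //= [RHS]addrA -IH => [|k kN|k kN]; last 2 first.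
- by apply: pq1; exact: ltnW.
- by apply: pq; exact: leqW.
have [pp qq pq'] := pq1 N (leqnn _).
rewrite -!addrA; congr (_ + _).
by rewrite !cphi //; apply: pq.
Qed.

End Cocycles.

(** * Homotopy invariance of cocycle classes *)

Section HomotopyInvariance.
Local Open Scope classical_set_scope.
Variables (R : realType) (V W : finType).
Variables (K : {set {set V}}) (L : {set {set W}}) (M : zmodType).
Hypothesis K_complex : simplicial_complex K.
Implicit Types (f g : realization R K -> realization R L).
Implicit Types (phi : realization R L -> realization R L -> M).

Lemma cocycle_pullback e f : continuous f -> 0 < e ->
  exists2 d, 0 < d & forall phi, cocycle e phi ->
    cocycle d (fun x y => phi (f x) (f y)).
Proof.
move=> cf e0; have [d d0 df] := uniformly_continuous K_complex cf e0.
exists d => // phi cphi x y z xy yz xz; apply: cphi; exact: df.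
Qed.

Lemma coboundary_pullback phi f : continuous f -> coboundary phi ->
  coboundary (fun x y => phi (f x) (f y)).
Proof.
move=> cf [h [e e0 eh]].
have [d d0 df] := uniformly_continuous K_complex cf e0.
by exists (h \o f), d => // x y xy; apply/eh/df.
Qed.

(* The primitive is the sum of phi along a fine subdivision of the track of a *)
(* point under the homotopy.                                                  *)
Lemma homotopic_coboundary e phi f g : homotopic R f g -> 0 < e ->
  cocycle e phi ->
  coboundary (fun x y => phi (g x) (g y) - phi (f x) (f y)).
Proof.
move=> [H [cH H0 H1]] e0 cphi.
have [d d0 dH] := homotopy_uniformly_continuous K_complex cH e0.
have [N Nd] := exists_invS_lt d0.
pose p x k := H (x, k%:R / N.+1%:R).
exists (fun x => \sum_(0 <= k < N.+1) phi (p x k) (p x k.+1)), d => // x y xy.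
have xx z : dist_lt d (\val z) (\val z) by exact: dist_lt_refl.
(* The ladder between the tracks of [x] and [y] has end rungs [phi (f x) (f y)] and
   [phi (g x) (g y)]. *)
have := @cocycle_ladder _ _ _ _ e phi (p x) (p y) N.+1 cphi.
rewrite /p mul0r divff ?pnatr_eq0 // !H0 !H1 => lad.
apply/eqP; rewrite subr_eq addrAC eq_sym subr_eq addrC [X in _ == X]addrC.
apply/eqP; rewrite -lad // => [k kN|k kN].
- have k01 := ratio_in01 R (ltnW kN).
  have k101 := ratio_in01 R kN.
  by split; apply: dH => //; rewrite ratio_step.
- by apply: dH; rewrite ?ratio_in01 // subrr normr0.
Qed.

End HomotopyInvariance.

(** * Comparison with simplicial cochains *)

Section Simplicial.
Variables (R : realType) (V : finType) (K : {set {set V}}).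
Hypothesis K_complex : simplicial_complex K.
Local Notation X := (realization R K).
Implicit Types (x y z : X) (a b : V) (e t : R).

(** The closed star: the points joined to [a] by a segment inside the complex. *)
Definition star a : set X := [set x | a |: vsupport (\val x) \in K]%classic.

(* [insubd] only returns its default value when [x] is not in the star of [a] *)
(* or [t] is not in [0, 1].                                                   *)
Definition line a x t : X :=
  insubd x ((fun v => (1 - t) * (v == a)%:R + t * \val x v) : coordinates R V).

(** The value is [x0] only when [a] is not a vertex of [K]. *)
Definition vertex x0 a : X :=
  insubd x0 ((fun v => (v == a)%:R) : coordinates R V).

Lemma sum_indicator a : \sum_(v : V) (v == a)%:R = 1 :> R.
Proof. by rewrite (bigD1 a) //= eqxx big1 ?addr0 // => v /negbTE ->. Qed.

Lemma val_line a x t v : star a x -> 0 <= t <= 1 ->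
  \val (line a x t) v = (1 - t) * (v == a)%:R + t * \val x v.
Proof.
move=> ax /andP[t0 t1]; rewrite /line val_insubd ifT //; apply/mem_set.
apply: (realization_set_sub K_complex ax) => [w||w].
- by rewrite addr_ge0 ?mulr_ge0 ?subr_ge0 ?ler0n ?realization_ge0.
- rewrite big_split -!mulr_sumr /= sum_indicator realization_sum1; ring.
- by rewrite !inE negb_or negbK => /andP[/negbTE -> /eqP ->];
    rewrite !mulr0 addr0.
Qed.

Lemma vertex_realization a : [set a]%SET \in K ->
  realization_set K ((fun v => (v == a)%:R) : coordinates R V).
Proof.
move=> aK; apply: (realization_set_sub K_complex aK) => [w||w].
- exact: ler0n.
- exact: sum_indicator.
- by rewrite inE => /negbTE ->.
Qed.

Lemma val_vertex x0 a v : [set a]%SET \in K -> \val (vertex x0 a) v = (v == a)%:R.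
Proof.
move=> aK; rewrite /vertex val_insubd ifT //; apply/mem_set.
exact: vertex_realization.
Qed.

Lemma realization_inj x y : (forall v, \val x v = \val y v) -> x = y.
Proof. by move=> xy; apply: val_inj; apply: funext. Qed.

Lemma simplex_sub (s t : {set V}) a :
  t \in K -> a \in s -> s \subset t -> s \in K.
Proof.
move=> tK as_ st; apply: (K_complex.2 _ _ tK st).
by apply/finset.set0Pn; exists a.
Qed.

Lemma vsupport_in_star a x : a \in vsupport (\val x) -> star a x.
Proof.
rewrite -finset.sub1set => ax; rewrite /star /= (finset.setUidPr ax).
exact: realization_support.
Qed.

Lemma star_vertex a x : star a x -> [set a]%SET \in K.
Proof.
by move=> ax; apply: (simplex_sub ax (finset.set11 a)); exact: finset.subsetUl.
Qed.

Lemma line0 a x x0 : star a x -> line a x 0 = vertex x0 a.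
Proof.
move=> ax; apply: realization_inj => v.
by rewrite val_line ?lexx ?ler01 // val_vertex ?(star_vertex ax) //; ring.
Qed.

Lemma line1 a x : star a x -> line a x 1 = x.
Proof.
by move=> ax; apply: realization_inj => v; rewrite val_line ?lexx ?ler01 //; ring.
Qed.

Lemma line_vertex x0 a t : [set a]%SET \in K -> 0 <= t <= 1 ->
  line a (vertex x0 a) t = vertex x0 a.
Proof.
move=> aK t01; apply: realization_inj => v; rewrite val_line //.
  by rewrite val_vertex //; ring.
rewrite /star /= (_ : _ |: _ = [set a])%SET //; apply/finset.setP => w.
by rewrite !inE val_vertex //; case: (w == a); rewrite ?eqxx ?orbT.
Qed.

Lemma vsupport_line a x t : star a x -> 0 <= t <= 1 ->
  vsupport (\val (line a x t)) \subset (a |: vsupport (\val x))%SET.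
Proof.
move=> ax t01; apply/fintype.subsetP => v; rewrite !inE val_line //.
case: (v == a) => //=; apply: contraNneq => ->; apply/eqP; ring.
Qed.

Lemma dist_lt_line_step a x s t e : star a x -> 0 <= s <= 1 -> 0 <= t <= 1 ->
  `|s - t| < e -> dist_lt e (\val (line a x s)) (\val (line a x t)).
Proof.
move=> ax s01 t01 st v; rewrite !val_line //.
rewrite (_ : _ - _ = (s - t) * (\val x v - (v == a)%:R)); last by ring.
rewrite normrM; apply: le_lt_trans st; rewrite ler_piMr //.
have := realization_ge0 x v; have := realization_le1 x v.
by case: (v == a) => /= ? ?; rewrite ler_norml; apply/andP; split; lra.
Qed.

Lemma dist_lt_line a x y s t d e : star a x -> star a y ->
  0 <= s <= 1 -> 0 <= t <= 1 -> `|s - t| < d ->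
  dist_lt e (\val x) (\val y) ->
  dist_lt (d + e) (\val (line a x s)) (\val (line a y t)).
Proof.
move=> ax ay s01 t01 st xy.
apply: (dist_lt_trans (dist_lt_line_step ax s01 t01 st)) => v.
rewrite !val_line // (_ : _ - _ = t * (\val x v - \val y v)); last by ring.
case/andP: t01 => t0 t1; rewrite normrM (ger0_norm t0).
by apply: le_lt_trans (xy v); rewrite ler_piMl.
Qed.

(** Some vertex of large coordinate, chosen without continuity; this is harmless since cocycles need
    not be continuous. *)
Definition nearest x : V := xchoose (realization_exists_large x).

Lemma nearest_large x : #|V|%:R^-1 <= \val x (nearest x).
Proof. exact: (xchooseP (realization_exists_large x)). Qed.

Lemma card_inv_gt0 x : 0 < #|V|%:R^-1 :> R.
Proof.
rewrite invr_gt0 ltr0n; apply/card_gt0P; by exists (nearest x).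
Qed.

Lemma nearest_support x : nearest x \in vsupport (\val x).
Proof.
by rewrite inE gt_eqF // (lt_le_trans (card_inv_gt0 x) (nearest_large x)).
Qed.

Lemma nearest_support_close x y : dist_lt #|V|%:R^-1 (\val x) (\val y) ->
  nearest x \in vsupport (\val y).
Proof.
move=> /(_ (nearest x)) xy; have xl := nearest_large x; rewrite inE.
apply: contraTneq xy => ->; rewrite subr0 -leNgt.
by rewrite ger0_norm ?realization_ge0.
Qed.

Lemma vsupport_vertex x0 a : [set a]%SET \in K ->
  vsupport (\val (vertex x0 a)) = [set a]%SET.
Proof.
move=> aK; apply/finset.setP => v.
by rewrite !inE val_vertex // pnatr_eq0 eqb0 negbK.
Qed.

Lemma nearest_vertex x0 a : [set a]%SET \in K -> nearest (vertex x0 a) = a.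
Proof.
by move=> aK; apply/finset.set1P; rewrite -(vsupport_vertex x0 aK) nearest_support.
Qed.

Variable M : zmodType.
Implicit Types (phi : X -> X -> M).

(** The discrete integral of [phi] along the segment from [a] to [x]. *)
Definition path_sum (N : nat) phi a x : M :=
  \sum_(0 <= k < N.+1)
    phi (line a x (k%:R / N.+1%:R)) (line a x (k.+1%:R / N.+1%:R)).

Lemma path_sum_vertex e N phi x0 a : 0 < e -> cocycle e phi ->
  [set a]%SET \in K -> path_sum N phi a (vertex x0 a) = 0.
Proof.
move=> e0 cphi aK; apply: big1_seq => k; rewrite mem_index_iota => /andP[_ kN].
by rewrite !line_vertex ?ratio_in01 ?(ltnW kN) // (cocycle_diag _ e0 cphi).
Qed.

(* On the star of a vertex the straight lines to that vertex trivialise a     *)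
(* cocycle.                                                                   *)
Lemma path_sum_primitive e N phi a x y : 0 < e -> cocycle e phi ->
  N.+1%:R^-1 < e / 2 -> star a x -> star a y ->
  dist_lt (e / 2) (\val x) (\val y) ->
  phi x y = path_sum N phi a y - path_sum N phi a x.
Proof.
move=> e0 cphi Ne ax ay xy; have e2 : 0 < e / 2 by rewrite divr_gt0.
have Ne' z z' k : (k < N.+1)%N -> star a z -> star a z' ->
    dist_lt (e / 2) (\val z) (\val z') ->
    dist_lt e (\val (line a z (k%:R / N.+1%:R)))
      (\val (line a z' (k.+1%:R / N.+1%:R))).
  move=> kN az az' zz'; rewrite [e]splitr.
  by apply: dist_lt_line; rewrite ?ratio_in01 ?ratio_step // ltnW.
have xx z : dist_lt (e / 2) (\val z) (\val z) by exact: dist_lt_refl.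
have := @cocycle_ladder _ _ _ _ e phi (fun k => line a x (k%:R / N.+1%:R))
  (fun k => line a y (k%:R / N.+1%:R)) N.+1 cphi.
(* Both segments start at the vertex [a], so the first rung is a diagonal value of [phi] and
   vanishes. *)
rewrite mul0r divff ?pnatr_eq0 // !line1 // (line0 x ax) (line0 x ay).
rewrite (cocycle_diag _ e0 cphi) add0r => lad.
apply/eqP; rewrite eq_sym subr_eq addrC; apply/eqP.
rewrite /path_sum -lad // => k kN; first by split; apply: Ne'.
rewrite [e]splitr; apply: dist_lt_line; rewrite ?ratio_in01 //.
by rewrite subrr normr0.
Qed.

(** Stokes on the triangle [a], [b], [x]: the integral from [a] is a primitive of [phi] along the
    segment from [b] to [x], and the sum telescopes. *)
Lemma path_sum_change e N phi a b x x0 : 0 < e -> cocycle e phi ->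
  N.+1%:R^-1 < e / 2 -> (a |: (b |: vsupport (\val x)))%SET \in K ->
  path_sum N phi b x =
  path_sum N phi a x - path_sum N phi a (vertex x0 b).
Proof.
move=> e0 cphi Ne abx.
have bx : star b x.
  by apply: (simplex_sub abx (finset.setU11 _ _)); exact: finset.subsetUr.
have al t : 0 <= t <= 1 -> star a (line b x t).
  move=> t01; apply: (simplex_sub abx (finset.setU11 _ _)).
  exact/finset.setUS/vsupport_line.
have := telescope_sumr
  (fun k => path_sum N phi a (line b x (k%:R / N.+1%:R))) (leq0n N.+1).
rewrite mul0r divff ?pnatr_eq0 // (line0 x0 bx) line1 // => <-.
apply: eq_big_nat => k /andP[_ kN].
have k01 := ratio_in01 R (ltnW kN); have k101 := ratio_in01 R kN.
apply: (path_sum_primitive e0 cphi Ne); [exact: al.. |].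
by apply: dist_lt_line_step; rewrite ?ratio_step.
Qed.

Lemma path_sum_anti e N phi a b x0 : 0 < e -> cocycle e phi ->
  N.+1%:R^-1 < e / 2 -> [set a; b]%SET \in K ->
  path_sum N phi b (vertex x0 a) = - path_sum N phi a (vertex x0 b).
Proof.
move=> e0 cphi Ne abK.
have aK : [set a]%SET \in K.
  by apply: (simplex_sub abK (finset.set11 _)); exact: finset.subsetUl.
rewrite (path_sum_change x0 (a := a) e0 cphi Ne).
  by rewrite (path_sum_vertex _ _ e0) // sub0r.
rewrite vsupport_vertex // finset.setUCA (finset.setUid [set a]%SET).
by rewrite finset.setUC.
Qed.

(** The primitive at [x] is [u] at the nearest vertex plus the integral from there to [x]. For close
    [x] and [y] both nearest vertices lie in the support of [y], so [path_sum_change] compares the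
    two base points. *)
Lemma path_sum_coboundary e N phi x0 (u : V -> M) : 0 < e -> cocycle e phi ->
  N.+1%:R^-1 < e / 2 ->
  (forall a b, [set a; b]%SET \in K ->
     path_sum N phi a (vertex x0 b) = u b - u a) ->
  coboundary phi.
Proof.
move=> e0 cphi Ne phiu.
exists (fun x => u (nearest x) + path_sum N phi (nearest x) x).
exists (Num.min (e / 2) #|V|%:R^-1) => [|x y xy].
  by rewrite lt_min divr_gt0 // (card_inv_gt0 x0).
have xye : dist_lt (e / 2) (\val x) (\val y).
  by apply: dist_lt_le xy; rewrite ge_min lexx.
have xs := nearest_support x; have ys := nearest_support y.
have xys : nearest x \in vsupport (\val y).
  apply: nearest_support_close.
  by apply: dist_lt_le xy; rewrite ge_min lexx orbT.
rewrite (path_sum_primitive e0 cphi Ne (vsupport_in_star xs)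
  (vsupport_in_star xys)) //.
rewrite (path_sum_change (a := nearest x) (b := nearest y) x0 e0 cphi Ne).
  rewrite phiu; last first.
    apply: (simplex_sub (realization_support y) (finset.set21 _ _)).
    by rewrite finset.subUset !finset.sub1set xys.
  rewrite opprB opprD.
  have bA (b a A : M) : b + (A + (a - b)) = A + a.
    by rewrite addrCA [a - b]addrC addNKr.
  by rewrite bA addrA addrK.
rewrite -finset.sub1set in ys; rewrite -finset.sub1set in xys.
by rewrite (finset.setUidPr ys) (finset.setUidPr xys) realization_support.
Qed.

Definition simplicial_cocycle (C : V -> V -> M) : Prop := forall s a b c,
  s \in K -> a \in s -> b \in s -> c \in s -> C a b + C b c = C a c.

Definition cocycle_of_simplicial (C : V -> V -> M) : X -> X -> M :=
  fun x y => C (nearest x) (nearest y).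

(** The three nearest vertices all lie in the support of the middle point [y]. *)
Lemma cocycle_of_simplicialP C :
  simplicial_cocycle C -> cocycle #|V|%:R^-1 (cocycle_of_simplicial C).
Proof.
move=> cC x y z xy yz xz; apply: cC (realization_support y) _ _ _.
- exact: nearest_support_close.
- exact: nearest_support.
- exact/nearest_support_close/dist_lt_sym.
Qed.

(** Walk from [a] to [b] in steps shorter than [e]: the nearest vertices met stay in [s], so the
    increments of [C] telescope to [C a b] and those of [h] to its difference at the two ends. *)
Lemma simplicial_coboundary C x0 :
  simplicial_cocycle C -> coboundary (cocycle_of_simplicial C) ->
  exists u : V -> M, forall s a b, s \in K -> a \in s -> b \in s ->
    C a b = u b - u a.
Proof.
move=> cC [h [e e0 eh]]; exists (fun b => h (vertex x0 b)) => s a b sK as_ bs.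
have aK : [set a]%SET \in K.
  by apply: (simplex_sub sK (finset.set11 _)); rewrite finset.sub1set.
have bK : [set b]%SET \in K.
  by apply: (simplex_sub sK (finset.set11 _)); rewrite finset.sub1set.
have ab : star a (vertex x0 b).
  apply: (simplex_sub sK (finset.setU11 _ _)).
  by rewrite vsupport_vertex // finset.subUset !finset.sub1set as_.
have [N Ne] := exists_invS_lt e0.
pose p k := line a (vertex x0 b) (k%:R / N.+1%:R).
have ps k : (k <= N.+1)%N -> nearest (p k) \in s.
  move=> kN; have := nearest_support (p k).
  move/(fintype.subsetP (vsupport_line ab (ratio_in01 R kN))).
  by rewrite vsupport_vertex // !inE => /orP[]/eqP->.
have Caa : C a a = 0.
  by apply: (@addrI _ (C a a)); rewrite addr0; apply: cC sK _ _ _.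
have pN : p N.+1 = vertex x0 b by rewrite /p divff ?pnatr_eq0 // line1.
have p0 : p 0%N = vertex x0 a by rewrite /p mul0r (line0 x0).
have := telescope_sumr (fun k => C a (nearest (p k))) (leq0n N.+1).
rewrite pN p0 !nearest_vertex // Caa subr0 => <-.
have := telescope_sumr (fun k => h (p k)) (leq0n N.+1).
rewrite pN p0 => <-.
apply: eq_big_nat => k /andP[_ kN].
rewrite -eh; last first.
  by apply: dist_lt_line_step; rewrite ?ratio_step ?ratio_in01 // ltnW.
apply/eqP; rewrite subr_eq addrC; apply/eqP/esym.
by apply: cC sK _ _ _ => //; apply: ps; rewrite // ltnW.
Qed.

End Simplicial.

(** * Cochains of the graphs Gamma *)

Section LinearAlgebra.
Variable F : fieldType.

(** [Psi], followed by projection to a complement of [Q], has kernel inside [P]; hence the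
    codimension of [P] is at most that of [Q]. *)
Lemma dim_preimage_le (A B : vectType F) (Psi : {linear A -> B})
    (P : {vspace A}) (Q : {vspace B}) :
  (forall c, Psi c \in Q -> c \in P) ->
  (\dim {:A} + \dim Q <= \dim P + \dim {:B})%N.
Proof.
move=> PsiQ; pose pr := daddv_pi Q^C Q; pose Theta := (pr \o linfun Psi)%VF.
have capQ : (Q^C :&: Q)%VS = 0%VS by rewrite capvC capv_compl.
have kerP : (lker Theta <= P)%VS.
  apply/subvP => c; rewrite memv_ker comp_lfunE lfunE /= => /eqP pr0.
  apply: PsiQ; rewrite -(daddv_pi_add capQ (w := Psi c)).
    by rewrite -/pr pr0 add0r memv_pi.
  by rewrite addvC addv_complf memvf.
have imQ : (limg Theta <= Q^C)%VS.
  by apply/subvP => _ /memv_imgP[c _ ->]; rewrite comp_lfunE memv_pi.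
have := limg_ker_dim Theta fullv; rewrite capfv => <-.
have := dimvS kerP; have := dimvS imQ; rewrite dimv_compl.
have := dimvS (subvf Q); lia.
Qed.

Lemma dim_ffun (I : finType) : \dim {: {ffun I -> F^o}} = #|I|.
Proof. by rewrite dimvf /dim /= muln1. Qed.

End LinearAlgebra.

Section GammaCochains.
Local Open Scope group_scope.
Variables (G : finGroupType) (S T : {group G}).
Implicit Types (H : {group G}) (x : G).

Definition coset_type H := {A : {set G} | A \in lcosets H [set: G]%SET}.

Lemma card_coset_type H : #|{: coset_type H}| = #|[set: G]%SET : H|.
Proof. by rewrite card_sig -card_lcosets; apply: eq_card. Qed.

Lemma mem_lcosets_setT H x : x *: H \in lcosets H [set: G]%SET.
Proof. by apply/lcosetsP; exists x. Qed.

Lemma coset_typeP H (z : coset_type H) : exists x, val z = x *: H.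
Proof. by case: z => A /= /lcosetsP[x _ ->]; exists x. Qed.

Lemma lcoset_mul (H K : {group G}) x : H \subset K -> (x *: H) * K = x *: K.
Proof. by move=> HK; rewrite -mulgA mulSGid. Qed.

Lemma lcosetI x : x *: S :&: x *: T = x *: (S :&: T).
Proof. by apply/finset.setP => y; rewrite !(inE, mem_lcoset). Qed.

Section Complex.
Variable m : nat.
Local Notation GV := (gamma_vertex G m).

Lemma gamma_edgeP i x (v : GV) :
  reflect (v = inl (x *: S) \/ v = inr (i, x *: T)) (v \in gamma_edge S T i x).
Proof. exact: finset.set2P. Qed.

Lemma Gamma_vertexS x : [set inl (x *: S)]%SET \in Gamma S T m.
Proof.
by apply/finset.setUP; left; apply/finset.setUP; left; exact: imset_f.
Qed.

Lemma Gamma_vertexT i x : [set inr (i, x *: T)]%SET \in Gamma S T m.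
Proof.
by apply/finset.setUP; left; apply/finset.setUP; right; exact: imset2_f.
Qed.

Lemma Gamma_edge i x : gamma_edge S T i x \in Gamma S T m.
Proof. by apply/finset.setUP; right; exact: imset2_f. Qed.

Lemma GammaP (s : {set GV}) : s \in Gamma S T m ->
  [\/ exists x, s = [set inl (x *: S)]%SET,
      exists i x, s = [set inr (i, x *: T)]%SET |
      exists i x, s = gamma_edge S T i x].
Proof.
move=> /finset.setUP[/finset.setUP[]|].
- by move=> /imsetP[x _ ->]; constructor 1; exists x.
- by move=> /imset2P[i x _ _ ->]; constructor 2; exists i, x.
- by move=> /imset2P[i x _ _ ->]; constructor 3; exists i, x.
Qed.

Lemma sub_edge_Gamma (s : {set GV}) i x :
  s \subset gamma_edge S T i x -> s != finset.set0 -> s \in Gamma S T m.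
Proof.
move=> /fintype.subsetP se /finset.set0Pn[v vs].
have [aS|aS] := boolP (inl (x *: S) \in s); last first.
  suff -> : s = [set inr (i, x *: T)]%SET.
    exact: Gamma_vertexT.
  apply/eqP; rewrite finset.eqEsubset; apply/andP; split.
    apply/fintype.subsetP => w ws; case/gamma_edgeP: (se w ws) => wE; last first.
      by rewrite wE finset.set11.
    by rewrite wE (negbTE aS) in ws.
  rewrite finset.sub1set; case/gamma_edgeP: (se v vs) => vE; last by rewrite -vE.
  by rewrite vE (negbTE aS) in vs.
have [bS|bS] := boolP (inr (i, x *: T) \in s).
  suff -> : s = gamma_edge S T i x.
    exact: Gamma_edge.
  apply/eqP; rewrite finset.eqEsubset finset.subUset !finset.sub1set aS bS.
  by rewrite !andbT; apply/fintype.subsetP.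
suff -> : s = [set inl (x *: S)]%SET by exact: Gamma_vertexS.
apply/eqP; rewrite finset.eqEsubset finset.sub1set aS andbT.
apply/fintype.subsetP => w ws; case/gamma_edgeP: (se w ws) => wE.
  by rewrite wE finset.set11.
by rewrite wE (negbTE bS) in ws.
Qed.

Hypothesis m_gt0 : (0 < m)%N.

Lemma Gamma_edgeE (s : {set GV}) : s \in Gamma S T m ->
  exists i x, s \subset gamma_edge S T i x.
Proof.
case/GammaP => [[x ->]|[i [x ->]]|[i [x ->]]].
- exists (Ordinal m_gt0), x; exact: finset.subsetUl.
- exists i, x; exact: finset.subsetUr.
- by exists i, x.
Qed.

Lemma Gamma_nonempty : finset.set0 \notin Gamma S T m.
Proof.
have N0 (A B : {set GV}) a : a \in A -> A <> finset.set0.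
  by move=> + A0; rewrite A0 inE.
apply/negP => /GammaP[[x /esym]|[i [x /esym]]|[i [x /esym]]]; apply: N0.
- exact: finset.set0. - exact: finset.set11.
- exact: finset.set0. - exact: finset.set11.
- exact: finset.set0. - exact: finset.set21.
Qed.

Lemma Gamma_complex : simplicial_complex (Gamma S T m).
Proof.
split=> [|s t /Gamma_edgeE[i [x se]] ts]; first exact: Gamma_nonempty.
exact: sub_edge_Gamma (fintype.subset_trans ts se).
Qed.

End Complex.

Variable F : fieldType.

(** Each edge is oriented from its [S]-end to its [T]-end. *)
Definition cochain m := {ffun 'I_m * coset_type (S :&: T) -> F^o}.

Definition vertex_cochain m := {ffun gamma_vertex G m -> F^o}.

Definition edge_value m (c : cochain m) (i : 'I_m) (A : {set G}) : F :=
  if insub A is Some z then c (i, z) else 0%R.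

(** An edge is recovered from its ends as their intersection, by [lcosetI]; non-adjacent vertices
    get the default 0 of [edge_value]. *)
Definition cochain_extend m (c : cochain m) (a b : gamma_vertex G m) : F :=
  match a, b with
  | inl A, inr (i, B) => edge_value c i (A :&: B)
  | inr (i, B), inl A => (- edge_value c i (A :&: B))%R
  | _, _ => 0%R
  end.

(** The ends of the edge with coset [z] are [z * S] and [z * T], by [lcoset_mul]. *)
Definition differential m (u : vertex_cochain m) : cochain m :=
  [ffun iz => (u (inr (iz.1, (val iz.2 * T)%g)) -
                u (inl (val iz.2 * S)%g))%R].

Lemma differential_is_linear m : linear (@differential m).
Proof.
move=> k u v; apply/ffunP => iz; rewrite !ffunE /=.
by rewrite scalerBr opprD addrACA.
Qed.

HB.instance Definition _ m := GRing.isLinear.Build F (vertex_cochain m)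
  (cochain m) *:%R (@differential m) (@differential_is_linear m).

Definition coboundaries m : {vspace cochain m} := limg (linfun (@differential m)).

Lemma coboundariesP m (c : cochain m) :
  reflect (exists u, c = differential u) (c \in coboundaries m).
Proof.
apply: (iffP memv_imgP) => [[u _ ->]|[u ->]]; exists u => //; rewrite ?memvf //.
  by rewrite lfunE.
by rewrite lfunE.
Qed.

Lemma dim_cochain m :
  \dim {: cochain m} = (m * #|[set: G]%SET : S :&: T|)%N.
Proof. by rewrite dim_ffun card_prod card_ord card_coset_type. Qed.

End GammaCochains.

(** * Growth of the space of coboundaries *)

Section CoboundaryDimension.
Local Open Scope group_scope.
Variables (G : finGroupType) (S T : {group G}) (F : fieldType).
Local Notation cochain := (cochain S T F).

Definition cochain_restrict m k (c : cochain (m + k)) : cochain m :=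
  [ffun iz => c (lshift k iz.1, iz.2)].

Lemma cochain_restrict_is_linear m k : linear (@cochain_restrict m k).
Proof. by move=> a c d; apply/ffunP => iz; rewrite !ffunE. Qed.

HB.instance Definition _ m k := GRing.isLinear.Build F (cochain (m + k))
  (cochain m) *:%R (@cochain_restrict m k) (@cochain_restrict_is_linear m k).

(** Cochains that vanish on the first [m] copies and depend only on the [T]-end of an edge on the
    last [k]. *)
Definition cochain_of_cosets m k (w : {ffun 'I_k * coset_type T -> F^o}) :
    cochain (m + k) :=
  [ffun iz : 'I_(m + k) * coset_type (S :&: T) =>
    match fintype.split iz.1 return F^o with
    | inl _ => 0%R
    | inr j => oapp (fun B => w (j, B)) 0%R (insub (val iz.2 * T))
    end].

Lemma cochain_of_cosets_is_linear m k : linear (@cochain_of_cosets m k).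
Proof.
move=> a c d; apply/ffunP => iz; rewrite !ffunE.
case: fintype.split => j; first by rewrite scaler0 addr0.
by case: insub => [B|] /=; rewrite ?ffunE // scaler0 addr0.
Qed.

HB.instance Definition _ m k := GRing.isLinear.Build F
  {ffun 'I_k * coset_type T -> F^o} (cochain (m + k)) *:%R
  (@cochain_of_cosets m k) (@cochain_of_cosets_is_linear m k).

(* The differential of u vanishes on a copy iff u is the same at both ends of *)
(* each of its edges. Then on the other copies it only depends on the         *)
(* T-vertex of an edge.                                                       *)
Lemma dim_coboundaries_add m k : (0 < m)%N ->
  (\dim (coboundaries S T F (m + k)) <=
   \dim (coboundaries S T F m) + k * #|[set: G]%SET : T|)%N.
Proof.
move=> m0; pose rho := linfun (@cochain_restrict m k).
(* Rank-nullity for restriction to the first [m] copies. *)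
rewrite -(limg_ker_dim rho (coboundaries _ _ _ _)) addnC leq_add //.
  apply/dimvS/subvP => _ /memv_imgP[_ /coboundariesP[u ->] ->].
  apply/coboundariesP; exists [ffun v => u match v with
    | inl A => inl A | inr (i, A) => inr (lshift k i, A) end].
  by rewrite lfunE; apply/ffunP => iz; rewrite !ffunE.
apply: (@leq_trans (\dim (limg (linfun (@cochain_of_cosets m k))))); last first.
  have := limg_ker_dim (linfun (@cochain_of_cosets m k)) fullv.
  by rewrite dim_ffun card_prod card_ord card_coset_type => <-; rewrite leq_addl.
apply/dimvS/subvP => c; rewrite memv_cap memv_ker lfunE.
move=> /andP[/coboundariesP[u ->] /eqP/ffunP ker].
pose i0 := Ordinal m0.
(* On copy [i0] the function [u] agrees at both ends of an edge, so its value at an [S]-vertex is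
   read off at the [T]-vertex there. *)
apply/memv_imgP; exists [ffun jB => (u (inr (rshift m jB.1, val jB.2)) -
  u (inr (lshift k i0, val jB.2)))%R]; rewrite ?memvf // lfunE.
apply/ffunP => -[i z]; rewrite [RHS]ffunE /=.
case: fintype.splitP => j ij.
  have := ker (j, z); rewrite !ffunE /= (_ : lshift k j = i) //.
  exact: val_inj.
have [x zx] := coset_typeP z.
have zT : val z * T \in lcosets T [set: G]%SET.
  by rewrite zx lcoset_mul ?subsetIr //; exact: mem_lcosets_setT.
rewrite insubT /= !ffunE /= (_ : rshift m j = i); last exact: val_inj.
by have := ker (i0, z); rewrite !ffunE /= => /eqP; rewrite subr_eq0 => /eqP ->.
Qed.

End CoboundaryDimension.

(** * Distinguishing the homotopy types *)

Section GammaHomotopy.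
Local Open Scope group_scope.
Variables (R : realType) (G : finGroupType) (S T : {group G}).
Local Notation F := rat.
Local Notation X m := (realization R (Gamma S T m)).

(** A graph has no triangles: three vertices of a simplex repeat one, and antisymmetry suffices. *)
Lemma cochain_extend_cocycle m (c : cochain S T F m) : (0 < m)%N ->
  simplicial_cocycle (Gamma S T m) (cochain_extend c).
Proof.
move=> m0 s a b d /(Gamma_edgeE m0)[i [x /fintype.subsetP se]].
move=> /se/gamma_edgeP[]-> /se/gamma_edgeP[]-> /se/gamma_edgeP[]-> /=;
  by rewrite ?addr0 ?add0r ?addrN ?addNr.
Qed.

Definition gamma_cocycle m (c : cochain S T F m) : X m -> X m -> F :=
  cocycle_of_simplicial (cochain_extend c).

Lemma edge_value_linear m (a : F) (c d : cochain S T F m) i A :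
  (edge_value (a *: c + d) i A = a * edge_value c i A + edge_value d i A)%R.
Proof.
by rewrite /edge_value; case: insub => [z|]; rewrite ?ffunE // mulr0 addr0.
Qed.

Lemma gamma_cocycle_linear m (a : F) (c d : cochain S T F m) x y :
  (gamma_cocycle (a *: c + d) x y =
   a * gamma_cocycle c x y + gamma_cocycle d x y)%R.
Proof.
rewrite /gamma_cocycle /cocycle_of_simplicial.
case: (nearest x) (nearest y) => [A|[i A]] [B|[j B]] /=;
  rewrite ?mulr0 ?addr0 ?edge_value_linear // mulrN opprD //.
Qed.

Lemma gamma_coboundary m (c : cochain S T F m) (x0 : X m) : (0 < m)%N ->
  coboundary (gamma_cocycle c) -> c \in coboundaries S T F m.
Proof.
move=> m0 /(simplicial_coboundary (Gamma_complex S T m0) x0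
  (cochain_extend_cocycle c m0))[u cu].
apply/coboundariesP; exists [ffun v => u v]; apply/ffunP => -[i z].
have [x zx] := coset_typeP z.
rewrite !ffunE /= zx !lcoset_mul ?subsetIl ?subsetIr //.
rewrite -(cu _ _ _ (Gamma_edge S T i x)) ?finset.set21 ?finset.set22 //=.
by rewrite lcosetI /edge_value -zx valK.
Qed.

Lemma gamma_cocycleP m (c : cochain S T F m) : (0 < m)%N ->
  cocycle #|gamma_vertex G m|%:R^-1 (gamma_cocycle c).
Proof. by move=> m0; exact/cocycle_of_simplicialP/cochain_extend_cocycle. Qed.

Lemma card_index_lt : ~~ (T \subset S) ->
  (#|[set: G]%SET : T| < #|[set: G]%SET : S :&: T|)%N.
Proof.
move=> TS; have STT : S :&: T \subset T by exact: subsetIr.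
rewrite -(Lagrange_index (finset.subsetT T) STT) ltn_Pmulr ?indexg_gt0 //.
rewrite indexg_gt1; apply: contra TS => /fintype.subset_trans; apply.
exact: subsetIl.
Qed.

(** Otherwise [Psi] would embed the first cohomology of [Gamma_(m+k)] into that of [Gamma_m], whose
    dimension is smaller. *)
Lemma Gamma_not_dominated m k (f : X (m + k) -> X m) (g : X m -> X (m + k)) :
  (0 < m)%N -> (0 < k)%N -> ~~ (T \subset S) ->
  continuous f -> continuous g -> ~ homotopic R (g \o f) id.
Proof.
move=> m0 k0 TS cf cg gf; have n0 : (0 < m + k)%N by rewrite addn_gt0 m0.
have Km := Gamma_complex S T m0; have Kn := Gamma_complex S T n0.
pose x0 : X m := exist (fun v => v \in @realization_set R _ (Gamma S T m)) _
  (mem_set (vertex_realization R Km (Gamma_vertexS S T m 1))).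
pose y0 := g x0; have e0 := card_inv_gt0 y0.
have [d d0 gd] := cocycle_pullback F Km cg e0.
have [N Nd] : exists N : nat, (N.+1%:R^-1 < d / 2)%R.
  by apply: exists_invS_lt; rewrite divr_gt0.
pose pull c := fun x y : X m => gamma_cocycle c (g x) (g y).
have pullP c : cocycle d (pull c) by apply/gd/gamma_cocycleP.
(* [Psi c] integrates the pullback of [c] along [g] over the edges of [Gamma_m]. *)
pose Psi (c : cochain S T F (m + k)) : cochain S T F m :=
  [ffun iz => path_sum N (pull c) (inl (val iz.2 * S))
                (vertex x0 (inr (iz.1, val iz.2 * T)))].
have Psi_lin : linear Psi.
  move=> a c c'; apply/ffunP => iz; rewrite !ffunE /path_sum.
  rewrite scaler_sumr -big_split /=; apply: eq_bigr => j _.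
  exact: gamma_cocycle_linear.
suff PsiP c : Psi c \in coboundaries S T F m -> c \in coboundaries S T F (m + k).
  pose PsiL : {linear _ -> _} :=
    HB.pack Psi (GRing.isLinear.Build _ _ _ _ Psi Psi_lin).
  have := @dim_preimage_le F _ _ PsiL _ _ PsiP; rewrite !dim_cochain.
  have arith (e v x y : nat) : (v < e -> x <= y + k * v ->
      (m + k) * e + y <= x + m * e -> False)%N by nia.
  exact: arith (card_index_lt TS) (dim_coboundaries_add S T F k m0).
move=> /coboundariesP[u cu]; apply: (gamma_coboundary y0) => //.
have pathST i x :
    path_sum N (pull c) (inl (x *: S)) (vertex x0 (inr (i, x *: T))) =
    (u (inr (i, x *: T)%g) - u (inl (x *: S)%g))%R.
  pose z : coset_type (S :&: T) :=
    exist (fun A => A \in lcosets (S :&: T) [set: G]%SET) _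
      (mem_lcosets_setT (S :&: T)%G x).
  move/ffunP: cu => /(_ (i, z)).
  by rewrite !ffunE /= !lcoset_mul ?subsetIl ?subsetIr.
have pull_cob : coboundary (pull c).
  apply: (path_sum_coboundary (x0 := x0) (u := fun v => u v : F) Km d0
    (pullP c) Nd).
  move=> a b abK.
  have aK : [set a]%SET \in Gamma S T m.
    by apply: (simplex_sub Km abK (finset.set11 _)); exact: finset.subsetUl.
  have := abK => /(Gamma_edgeE m0)[i [x]].
  rewrite finset.subUset !finset.sub1set => /andP[].
  move=> /gamma_edgeP[]aE /gamma_edgeP[]bE; rewrite aE bE in abK aK *.
  - by rewrite (path_sum_vertex Km N x0 d0 (pullP c) aK) subrr.
  - exact: pathST.
  - rewrite finset.setUC in abK.
    by rewrite (path_sum_anti Km x0 d0 (pullP c) Nd abK) pathST opprB.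
  - by rewrite (path_sum_vertex Km N x0 d0 (pullP c) aK) subrr.
(* The pullback of [c] along [g \o f] is trivial, and it is cohomologous to the cocycle of [c]
   itself. *)
have := coboundary_pullback Kn cf pull_cob.
have := homotopic_coboundary Kn gf e0 (gamma_cocycleP c n0).
move=> h1 h2; have := coboundaryD h1 h2.
by congr coboundary; do 2!apply: funext => ?; rewrite /pull /= subrK.
Qed.

End GammaHomotopy.

(** * Contractions *)

Section Contractions.
Local Open Scope classical_set_scope.
Variables (R : realType) (V : finType) (K : {set {set V}}).
Hypothesis K_complex : simplicial_complex K.
Local Notation X := (realization R K).

Lemma line_continuous (Z : topologicalType) (D : set Z) (f : Z -> X)
    (tau : Z -> R) (a : V) :
  continuous f -> continuous tau ->
  (forall z, D z -> star a (f z) /\ 0 <= tau z <= 1) ->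
  {within D, continuous (fun z => line a (f z) (tau z))}.
Proof.
move=> cf ctau fD; apply/subspace_continuousP => z Dz U.
move=> /nbhs_realization[e e0 eU]; have e2 : 0 < e / 2 by rewrite divr_gt0.
have fz : nbhs z [set z' | dist_lt (e / 2) (\val (f z)) (\val (f z'))].
  apply: (cf z [set y | dist_lt (e / 2) (\val (f z)) (\val y)]).
  by apply/nbhs_realization; exists (e / 2).
have tz : nbhs z [set z' | `|tau z - tau z'| < e / 2].
  exact: (ctau z _ (nbhsx_ballx (tau z) _ e2)).
apply: (@filterS _ _ (nbhs_filter z) _ _ _ (filterI fz tz)).
move=> z' [/= fz' tz'] Dz'.
have [sz t01] := fD z Dz; have [sz' t01'] := fD z' Dz'.
by apply: eU; rewrite [e]splitr; exact: dist_lt_line.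
Qed.

Variables (G : finGroupType) (to : {action G &-> V}).

(** Every point slides straight to the apex; time is reversed because [line] starts there. The
    action is linear and [N] fixes [a], so the slide is equivariant. *)
Lemma cone_contractible (N : {set G}) (a : V) :
  [set a]%SET \in K -> (forall s, s \in K -> (a |: s)%SET \in K) ->
  [acts N, on K | to^*] -> (forall g, g \in N -> to a g = a) ->
  equivariantly_contractible R N (@realization_act _ _ to R K).
Proof.
move=> aK cone actK fixa.
have star_all (x : X) : star a x by apply: cone; exact: realization_support.
pose x0 : X := exist (fun v => v \in @realization_set R _ K) _
  (mem_set (vertex_realization R K_complex aK)).
exists (vertex x0 a), (fun xt => line a xt.1 (1 - xt.2)).
have t01' (t : R) : 0 <= t <= 1 -> 0 <= 1 - t <= 1.
  by move=> /andP[t0 t1]; apply/andP; split; lra.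
split; first split.
- apply: line_continuous => [x|x|[x t] [_ /=]]; first exact: cvg_fst.
    by apply: cvgB; [exact: cvg_cst | exact: cvg_snd].
  by rewrite in_itv /= => t01; split; [exact: star_all | exact: t01'].
- by move=> x; rewrite /= subr0 line1.
- by move=> x; rewrite /= subrr (line0 K_complex x0).
- move=> g x t gN /t01' t01; apply: realization_inj => v /=.
  rewrite (realization_actE _ actK gN) /coordinates_act !val_line //.
  rewrite (realization_actE _ actK gN) /coordinates_act.
  by rewrite -{2}(fixa g gN) (inj_eq (act_inj to g)).
Qed.

End Contractions.

(** * Strongly embedded subgroups and p-subgroups *)

Section StronglyEmbedded.
Local Open Scope group_scope.
Variables (G : finGroupType) (p : nat) (S : {group G}).
Hypotheses (p_prime : prime p) (S_embedded : strongly_embedded p S).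

(** [P :^ x \subset S] says that [P] fixes [xS]. With [g = x^-1 * y], the group [P :^ x] lies in
    both [S] and [S :^ g^-1], which forces [g] into [S]. *)
Lemma strongly_embedded_mem (P : {group G}) (x y : G) :
  p.-group P -> P :!=: 1 -> P :^ x \subset S -> P :^ y \subset S ->
  x *: S = y *: S.
Proof.
move=> pP P1 PxS PyS; have [_ pPd _] := pgroup_pdiv pP P1.
have [_ _ Sg] := S_embedded.
suff gS : x^-1 * y \in S by apply/esym/lcoset_eqP; rewrite mem_lcoset.
apply: contraLR pPd => /Sg; apply: contraNN => pPd.
apply: (dvdn_trans pPd); rewrite -(cardJg P x); apply: cardSg.
by rewrite finset.subsetI PxS -sub_conjg -conjsgM mulKVg.
Qed.

(* The normaliser of a Sylow p-subgroup of S stays in S, so it is a Sylow     *)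
(* p-subgroup of G.                                                           *)
Lemma strongly_embedded_sub (P : {group G}) :
  p.-group P -> exists x, P :^ x \subset S.
Proof.
have [_ pS Sg] := S_embedded => pP.
have [a aS oa] := Cauchy p_prime pS.
have pa : p.-group <[a]> by rewrite /pgroup -orderE oa pnat_id.
have aSs : <[a]> \subset S by rewrite cycle_subG.
have [Q sylQ aQ] := Sylow_superset aSs pa.
have pQ : (p %| #|Q|)%N by rewrite -oa orderE cardSg.
have QS := pHall_sub sylQ; have pgQ := pHall_pgroup sylQ.
have NQ : 'N(Q) \subset S.
  apply/fintype.subsetP => g /normP QgQ.
  apply: contraLR pQ => /Sg; apply: contraNN => pQ; apply: (dvdn_trans pQ).
  apply: cardSg; rewrite finset.subsetI QS.
  by rewrite -sub_conjg QgQ.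
have [U sylU QU] := Sylow_superset (finset.subsetT Q) pgQ.
have pgU := pHall_pgroup sylU.
have UQ : U = Q.
  (* Normalisers grow in the p-group [U], so it is enough that [Q] is its own normaliser in [U]. *)
  apply/group_inj/(nilpotent_sub_norm (pgroup_nil pgU) QU).
  rewrite (sub_pHall sylQ (K := (U :&: 'N(Q))%G)) //.
  - by rewrite (pgroupS _ pgU) // finset.subsetIl.
  - by rewrite finset.subsetI QU normG.
  - by rewrite (fintype.subset_trans _ NQ) // finset.subsetIr.
rewrite UQ in sylU.
have [x _ Px] := Sylow_subJ sylU (finset.subsetT P) pP.
by exists x^-1; rewrite sub_conjgV (fintype.subset_trans Px) // conjSg.
Qed.

End StronglyEmbedded.

(** * The building conditions for Gamma *)

Section GammaBuilding.
Local Open Scope group_scope.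
Variables (G : finGroupType) (S T : {group G}) (m : nat).
Hypothesis m_gt0 : (0 < m)%N.
Local Notation GV := (gamma_vertex G m).
Local Notation to := (gamma_act G m).
Local Notation K := (Gamma S T m).
Implicit Types (H P : {group G}) (x g : G).

Lemma gamma_act_edge i x g (v : GV) :
  v \in gamma_edge S T i x -> to v g \in gamma_edge S T i (g^-1 * x).
Proof.
by move=> /gamma_edgeP[]-> /=; rewrite !inE /= !lcosetM !eqxx ?orbT.
Qed.

Lemma lcoset_fixed H x g : (g^-1 *: (x *: H) == x *: H) = (g \in H :^ x^-1).
Proof.
rewrite -[in RHS]groupV mem_conjg invgK conjgE -mem_lcoset -lcosetM.
by apply/eqP/idP => [<-|/lcoset_eqP //]; rewrite lcoset_refl.
Qed.

Lemma gamma_acts : [acts [set: G]%SET, on K | to^*].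
Proof.
have Kto (s : {set GV}) g : s \in K -> to^*%act s g \in K.
  move=> sK; have [i [x se]] := Gamma_edgeE m_gt0 sK.
  apply: (@sub_edge_Gamma _ _ _ _ _ i (g^-1 * x)).
    apply/fintype.subsetP => _ /imsetP[v vs ->].
    exact/gamma_act_edge/(fintype.subsetP se).
  have /finset.set0Pn[v vs] : s != finset.set0.
    by apply: contraNneq (Gamma_nonempty S T m) => <-.
  by apply/finset.set0Pn; exists (to v g); exact: imset_f.
apply/actsP => g _ s; apply/idP/idP; last exact: Kto.
by move/(Kto _ g^-1); rewrite actK.
Qed.

(** The ends of an edge are of different kinds, so no group element swaps them. *)
Lemma gamma_astabs (s : {set GV}) : s \in K -> 'N(s | to) \subset 'C(s | to).
Proof.
move=> /(Gamma_edgeE m_gt0)[i [x /fintype.subsetP se]].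
apply/fintype.subsetP => g gN; apply/astabP => v vs.
have vgs : to v g \in s by rewrite (astabs_act _ gN).
by case/gamma_edgeP: (se v vs) vgs => -> /se/gamma_edgeP[] /= e.
Qed.

Lemma gamma_G_complex : G_simplicial_complex to K.
Proof.
split; [exact: Gamma_complex | exact: gamma_acts | exact: gamma_astabs].
Qed.

Lemma gamma_edge_stabilizer i x (s : {set GV}) : s \subset gamma_edge S T i x ->
  (S :&: T) :^ x^-1 \subset 'N(s | to).
Proof.
move=> se; apply: (fintype.subset_trans _ (astab_sub _ _)).
apply: (fintype.subset_trans _ (astabS _ se)).
rewrite conjIg; apply/fintype.subsetP => g /finset.setIP[gS gT].
have fixH H : g \in H :^ x^-1 -> g^-1 *: (x *: H) = x *: H.
  by rewrite -lcoset_fixed => /eqP.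
by apply/astabP => v /gamma_edgeP[]->; rewrite /= fixH.
Qed.

Lemma Gamma_dimension : has_dimension K 1.
Proof.
split; first by exists (gamma_edge S T (Ordinal m_gt0) 1);
  [exact: Gamma_edge | rewrite cards2].
move=> s /(Gamma_edgeE m_gt0)[i [x /subset_leq_card /leq_trans]]; apply.
by rewrite cards2.
Qed.

Lemma gamma_fixS P x :
  (P \subset 'C([set inl (x *: S) : GV]%SET | to)) = (P :^ x \subset S).
Proof.
rewrite sub_conjg; apply: eq_subset_r => g.
by rewrite (sameP astab1P eqP) -lcoset_fixed.
Qed.

Lemma gamma_fixT P i x :
  (P \subset 'C([set inr (i, x *: T) : GV]%SET | to)) = (P :^ x \subset T).
Proof.
rewrite sub_conjg; apply: eq_subset_r => g; rewrite (sameP astab1P eqP).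
by rewrite -lcoset_fixed /= /eq_op /= xpair_eqE eqxx.
Qed.

Lemma mem_fixed_subcomplex P (s : {set GV}) :
  (s \in fixed_subcomplex to P K) = (s \in K) && (P \subset 'C(s | to)).
Proof. by rewrite inE. Qed.

Variable p : nat.
Hypotheses (p_prime : prime p) (S_embedded : strongly_embedded p S).
Hypothesis T_transporter : forall g : G, g \in S -> #[g] = p ->
  transporter <[g]> T \subset T * S.

(* By the transporter hypothesis every fixed vertex yT is joined by a fixed   *)
(* edge to the unique fixed vertex xS.                                        *)
Lemma gamma_common_coset P x y : p.-group P -> P :!=: 1 ->
  P :^ x \subset S -> P :^ y \subset T ->
  exists z, x *: S = z *: S /\ y *: T = z *: T.
Proof.
move=> pP P1 PxS PyT; have [_ pPd _] := pgroup_pdiv pP P1.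
have [g gP og] := Cauchy p_prime pPd.
have gxS : g ^ x \in S by apply: (fintype.subsetP PxS); rewrite memJ_conjg.
have ogx : #[g ^ x] = p by rewrite orderJ.
have /(fintype.subsetP (T_transporter gxS ogx))/mulsgP[t s tT sS yx] :
    y^-1 * x \in transporter <[g ^ x]> T.
  rewrite inE -cycleJ cycle_subG -conjgM invMg invgK mulKVg.
  by apply: (fintype.subsetP PyT); rewrite memJ_conjg.
(* Here [x = y * t * s] with [t] in [T] and [s] in [S]. *)
exists (y * t); split; last by rewrite lcosetM (lcoset_id tT).
by rewrite -[x](mulKVg y) yx mulgA lcosetM (lcoset_id sS).
Qed.

(** The apex is the only [S]-vertex of a fixed simplex, and [gamma_common_coset] joins it to any
    fixed [T]-vertex. *)
Lemma gamma_fixed_cone P x (s : {set GV}) : p.-group P -> P :!=: 1 ->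
  P :^ x \subset S -> s \in fixed_subcomplex to P K ->
  (inl (x *: S) |: s)%SET \in fixed_subcomplex to P K.
Proof.
move=> pP P1 PxS; rewrite !mem_fixed_subcomplex => /andP[sK Ps].
rewrite astabU finset.subsetI gamma_fixS PxS Ps !andbT.
have Sx y : inl (y *: S) \in s -> y *: S = x *: S.
  move=> ys; apply: (strongly_embedded_mem S_embedded pP P1 _ PxS).
  by rewrite -gamma_fixS (fintype.subset_trans Ps) // astabS // finset.sub1set.
have Tx i y : inr (i, y *: T) \in s ->
    exists z, x *: S = z *: S /\ y *: T = z *: T.
  move=> ys; apply: (gamma_common_coset pP P1 PxS).
  rewrite -(gamma_fixT _ i) (fintype.subset_trans Ps) // astabS //.
  by rewrite finset.sub1set.
case/GammaP: (sK) => [[y sE]|[i [y sE]]|[i [y sE]]].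
- by rewrite sE -(Sx y) ?finset.setUid ?sE ?finset.set11 // -sE.
- have [|z [xz yz]] := Tx i y; first by rewrite sE finset.set11.
  by rewrite sE xz yz; exact: Gamma_edge.
- rewrite -(Sx y) ?sE ?finset.set21 // (finset.setUidPr _) -?sE //.
  by rewrite finset.sub1set sE finset.set21.
Qed.

(** The normaliser permutes the [S]-vertices fixed by [P], and there is only one. *)
Lemma gamma_norm_apex P x g : p.-group P -> P :!=: 1 ->
  P :^ x \subset S -> g \in 'N(P) -> to (inl (x *: S)) g = inl (x *: S).
Proof.
move=> pP P1 PxS gN; rewrite /= -lcosetM; congr inl.
apply: (strongly_embedded_mem S_embedded pP P1 _ PxS).
have /normP gVN : g^-1 \in 'N(P) by rewrite groupV.
by rewrite conjsgM gVN.
Qed.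

Lemma fixed_subcomplex_complex P : simplicial_complex (fixed_subcomplex to P K).
Proof.
have [K0 Ksub] := Gamma_complex S T m_gt0; split.
  by rewrite inE (negbTE K0).
move=> s t; rewrite !mem_fixed_subcomplex => /andP[sK Ps] ts t0.
by rewrite (Ksub s) //= (fintype.subset_trans Ps) // astabS.
Qed.

Lemma Gamma_synthetic_building (R : realType) : (p %| #|(S :&: T)%SET|)%N ->
  synthetic_building to R p K.
Proof.
move=> pST; split; first exact: gamma_G_complex.
  move=> P pP P1; have [x PxS] := strongly_embedded_sub p_prime S_embedded pP.
  apply: (cone_contractible R (fixed_subcomplex_complex P) (a := inl (x *: S))).
  - by rewrite mem_fixed_subcomplex Gamma_vertexS gamma_fixS.
  - by move=> s; exact: gamma_fixed_cone.
  - exact: fixed_subcomplex_acts gamma_acts.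
  - by move=> g; exact: gamma_norm_apex PxS.
move=> s /(Gamma_edgeE m_gt0)[i [x /gamma_edge_stabilizer/cardSg]].
by rewrite cardJg; exact: dvdn_trans.
Qed.

End GammaBuilding.

(** * The orbit space *)

Section GammaSlender.
Local Open Scope group_scope.
Variables (R : realType) (G : finGroupType) (S T : {group G}) (m : nat).
Hypothesis m_gt0 : (0 < m)%N.
Local Notation GV := (gamma_vertex G m).
Local Notation to := (gamma_act G m).
Local Notation K := (Gamma S T m).
Local Notation X := (realization R K).
Local Notation Q := (orbit_space to R K).

(* The quotient map onto the star with centre S and leaves T_1, ..., T_m,     *)
(* which is a subcomplex of Gamma.                                            *)
Definition fold_coordinates (x : coordinates R GV) : coordinates R GV :=
  fun v => match v with
  | inl A => if A == S then (\sum_(B : {set G}) x (inl B))%R else 0%R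
  | inr (i, A) => if A == T then (\sum_(B : {set G}) x (inr (i, B)))%R else 0%R
  end.

(** A point lies on one edge, say that of [h]; translation by [h^-1] moves it into the star, and
    each sum has at most one non-zero term. *)
Lemma fold_coordinates_orbit (x : X) :
  exists g, fold_coordinates (\val x) = coordinates_act to g (\val x).
Proof.
have [i [h se]] := Gamma_edgeE m_gt0 (realization_support x).
have x0 v : v \notin gamma_edge S T i h -> \val x v = 0%R.
  move=> vh; apply/eqP; apply: contraNT vh => xv.
  by apply: (fintype.subsetP se); rewrite inE.
exists h^-1; apply: funext => v; rewrite /coordinates_act /=.
have sumS : (\sum_(B : {set G}) \val x (inl B))%R = \val x (inl (h *: S)).
  rewrite (bigD1 (h *: S)) //= big1 ?addr0 // => B BS; apply: x0.
  by apply: contraNN BS => /gamma_edgeP[] // [->].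
have sumT j :
    (\sum_(B : {set G}) \val x (inr (j, B)))%R = \val x (inr (j, h *: T)).
  rewrite (bigD1 (h *: T)) //= big1 ?addr0 // => B BT; apply: x0.
  by apply: contraNN BT => /gamma_edgeP[] // [_ ->].
case: v => [A|[j A]] /=; rewrite invgK ?sumS ?sumT.
  have [->//|AS] := eqVneq A S; rewrite x0 //.
  by apply: contraNN AS => /gamma_edgeP[] // [/lcoset_inj ->].
have [->//|AT] := eqVneq A T; rewrite x0 //.
by apply: contraNN AT => /gamma_edgeP[] // [_ /lcoset_inj ->].
Qed.

Lemma fold_coordinates_act g (x : coordinates R GV) :
  fold_coordinates (coordinates_act to g x) = fold_coordinates x.
Proof.
apply: funext => -[A|[i A]] /=; case: ifP => // _.
  by rewrite [RHS](reindex_inj (@lcoset_inj _ g^-1)).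
by rewrite [RHS](reindex_inj (@lcoset_inj _ g^-1)).
Qed.

Definition fold (x : X) : X := insubd x (fold_coordinates (\val x)).

Lemma val_fold (x : X) : \val (fold x) = fold_coordinates (\val x).
Proof.
rewrite /fold val_insubd ifT //; have [g ->] := fold_coordinates_orbit x.
rewrite -(realization_actE _ (gamma_acts S T m_gt0) (finset.in_setT g)).
exact: valP.
Qed.

Lemma fold_continuous : continuous fold.
Proof.
apply: realization_continuous => v.
rewrite (_ : (fun x => _) = (fun x : X => fold_coordinates (\val x) v)); last first.
  by apply: funext => x; rewrite val_fold.
have val_continuous w : continuous (fun x : X => \val x w).
  move=> x; apply: (@continuous_comp _ _ _ (fun y : X => \val y)
    (fun y : coordinates R GV => y w)); last exact: coordinate_continuous.
  exact: realization_val_continuous.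
case: v => [A|[i A]] /=.
  case: (A == S); last exact: (@cst_continuous X R 0%R).
  apply: continuous_big => [|B _]; first exact: add_continuous.
  exact: val_continuous.
case: (A == T); last exact: (@cst_continuous X R 0%R).
apply: continuous_big => [|B _]; first exact: add_continuous.
  exact: val_continuous.
Qed.

Lemma star_fold (x : X) : star (inl (1 *: S)) (fold x).
Proof.
have [i [h se]] := Gamma_edgeE m_gt0 (realization_support (fold x)).
rewrite /star /=; apply: (@sub_edge_Gamma _ _ _ _ _ i 1); last first.
  by apply/finset.set0Pn; exists (inl (1 *: S)); rewrite finset.setU11.
apply/fintype.subsetP => v /finset.setU1P[->|]; first exact: finset.set21.
move=> vx; have := vx; rewrite inE val_fold => fv; apply/gamma_edgeP.
rewrite !mul1g; case/gamma_edgeP: (fintype.subsetP se v vx) fv => -> /=.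
  by have [-> _|_] := eqVneq (h *: S) S; [left | rewrite eqxx].
by have [-> _|_] := eqVneq (h *: T) T; [right | rewrite eqxx].
Qed.

Local Open Scope quotient_scope.

Lemma pi_fold (x : X) : \pi_Q (fold x) = \pi_Q x.
Proof.
apply/eqmodP/existsP; have [g fg] := fold_coordinates_orbit x.
exists g^-1; rewrite val_fold fg; apply/eqP/funext => v.
by rewrite /coordinates_act actKV.
Qed.

Lemma fold_orbit (x y : X) : \pi_Q x = \pi_Q y -> fold x = fold y.
Proof.
move=> /eqmodP/existsP[g /eqP e]; apply: val_inj.
by rewrite !val_fold e fold_coordinates_act.
Qed.

Local Open Scope classical_set_scope.

(** Fold a representative into the star, slide it to the centre and project. [repr] may jump within
    an orbit, but [fold \o repr] is continuous because [fold] is constant on orbits. *)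
Lemma Gamma_slender : slender to R K.
Proof.
have Kc := Gamma_complex S T m_gt0.
pose apex : GV := inl (1 *: S).
pose x0 : X := exist (fun v => v \in @realization_set R _ K) _
  (mem_set (vertex_realization R Kc (Gamma_vertexS S T m 1))).
exists (\pi_Q (vertex x0 apex)).
exists (fun qt => \pi_Q (line apex (fold (repr qt.1)) (1 - qt.2)%R)).
have t01' (t : R) : (0 <= t <= 1 -> 0 <= 1 - t <= 1)%R.
  by move=> /andP[t0 t1]; apply/andP; split; lra.
split.
- have cline : {within [set: Q] `*` `[0%R, 1%R],
      continuous (fun qt : Q * R => line apex (fold (repr qt.1)) (1 - qt.2)%R)}.
    apply: (line_continuous Kc (f := fun qt : Q * R => fold (repr qt.1))
      (tau := fun qt : Q * R => (1 - qt.2)%R)).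
    + have cf : continuous (fold \o repr : Q -> X).
        apply: repr_comp_continuous; first exact: fold_continuous.
        by move=> x y /eqP/fold_orbit ->.
      move=> qt; apply: (@continuous_comp _ _ _ (fst : Q * R -> Q)
        (fold \o repr : Q -> X)); [exact: cvg_fst | exact: cf].
    + by move=> qt; apply: cvgB; [exact: cvg_cst | exact: cvg_snd].
    + move=> [q t] [_ /=]; rewrite in_itv /= => t01.
      by split; [exact: star_fold | exact: t01'].
  move=> qt; apply: continuous_comp; first exact: cline.
  exact: pi_continuous.
- by move=> q; rewrite /= subr0 line1 // ?pi_fold ?reprK //; exact: star_fold.
- by move=> q; rewrite /= subrr (line0 Kc x0) //; exact: star_fold.
Qed.

End GammaSlender.

Theorem theorem6p14 (R : realType) (G : finGroupType) (p : nat)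
    (S T : {group G})
    (p_prime : prime p)
    (S_embedded : strongly_embedded p S)
    (T_transporter : forall g : G, g \in S -> #[g]%g = p ->
      transporter <[g]>%g T \subset (T * S)%g)
    (p_dvd_ST : (p %| #|(S :&: T)%SET|)%N)
    (T_notin_S : ~~ (T \subset S)) :
  (forall m : nat, (1 <= m)%N ->
    [/\ synthetic_building (gamma_act G m) R p (Gamma S T m),
        has_dimension (Gamma S T m) 1 &
        slender (gamma_act G m) R (Gamma S T m)]) /\
  (forall m n : nat, (1 <= m)%N -> (1 <= n)%N -> m <> n ->
    ~ homotopy_equivalent R (realization R (Gamma S T m))
                            (realization R (Gamma S T n))).
Proof.
split=> [m m1|m n m1 n1 mn [f [g [cf cg gf fg]]]].
  split; last exact: Gamma_slender; last exact: Gamma_dimension.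
  exact: (Gamma_synthetic_building m1 p_prime S_embedded T_transporter).
have lt_sum i j : (i < j)%N -> exists2 k, (0 < k)%N & j = (i + k)%N.
  by move=> ij; exists (j - i)%N; lia.
(* The composite on the larger graph contradicts [Gamma_not_dominated]. *)
have [/lt_sum[k k0 nE]|/lt_sum[k k0 mE]|//] := ltngtP m n.
  by subst n; exact: (Gamma_not_dominated m1 k0 T_notin_S cg cf fg).
by subst m; exact: (Gamma_not_dominated n1 k0 T_notin_S cf cg gf).
Qed.
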